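(* Consider the discrete-time stochastic control problem described in the context, with state $X_t=(p_t,q_t)^T$, real control $u_t$, dynamics $$X_{t+\delta t} = \begin{pmatrix} 1-\kappa_t\delta t & 0\\ 0 & 1\end{pmatrix}X_t + a_tu_tw_t\,\delta t+\begin{pmatrix}\sigma_{t,\delta t}z_t\\0\end{pmatrix},$$ stage costs $j_t(X,u)\,\delta t$, terminal cost $J_T$ and value function $H$. Let $X=(p,q)^T$, $\mathcal I=\mathrm{diag}(1,1)$, $\mathcal J=\mathrm{diag}(1,0)$, and $e_1=(1,0)^T$. The value function $H$ is quadratic in $X$, of the form $$H(t,X)=X^TP_tX+b_t^TX+e_t.$$ The optimal control $u_t^*$ is of the form $$u_t^*=k_t^TX_t+f_t$$ with $$k_t=-\frac1{g_t}\Big((\mathcal I-\kappa_t\delta t\,\mathcal J)P_{t+\delta t}^Tw_t+\tfrac12e_1\Big),\qquad f_t=-\frac{b_{t+\delta t}^Tw_t+s_t}{2g_t},\qquad g_t=\eta_t+a_tw_t^TP_{t+\delta t}w_t\,\delta t.$$ Moreover, we have the backward iteration scheme $$P_t=P_{t+\delta t}-\kappa_t\delta t(\mathcal JP_{t+\delta t}+P_{t+\delta t}\mathcal J)+\kappa_t^2(\delta t)^2\mathcal JP_{t+\delta t}\mathcal J+\big[\Delta_t-a_tg_tk_tk_t^T\big]\delta t,$$ $$b_t=b_{t+\delta t}-\big\{2a_tg_tf_tk_t+\kappa_t\mathcal Jb_{t+\delta t}\big\}\delta t,$$ $$e_t=e_{t+\delta t}+\sigma_{t,\delta t}^2\,e_1^TP_{t+\delta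 t}e_1-a_tg_tf_t^2\,\delta t,$$ where $\Delta_t=\begin{pmatrix}0&0\\0&\beta_t\end{pmatrix}$, and with the terminal conditions $P_T=\begin{pmatrix}0&0\\0&\tilde\beta_T\end{pmatrix}$, $b_T=(0,0)^T$, $e_T=0$.
   Context: Time grid: $t=0,\delta t,\dots,n\delta t=T$; all sums over time run over the grid. Parameters: $Q_0$ (initial quantity to execute), $v_t$ (expected market volume rate over $[t,t+\delta t)$), $a_t=v_t/Q_0$, $\eta_t$ (deterministic temporary impact), $\mu_t$ (deterministic linear permanent impact), $w_t=(Q_0\mu_t,-1)^T$, $s_t$ (half-spread in proportion of the arrival price), $\kappa_t$ (mean-reversion), $\beta_t$ (urgency), $\tilde\beta_T$ (terminal penalty), $\sigma_{t,\delta t}$ (volatility over a bucket). The $z_t$ are i.i.d. standard normal random variables. State: $X_t=(p_t,q_t)^T$, where $p_t$ is the price slippage and $q_t$ the proportion of non-executed shares. The control $u_t$ (participation rate) is real-valued, with no sign constraint. Costs: for $X=(p,q)^T$, $$j_t(X,u)=a_t\eta_tu^2+a_t(p+s_t)u+\beta_tq^2,\qquad J_T(X)=\tilde\beta_Tq^2.$$ Value function: $$H(t,X)=\inf_{(u_\tau)_{\tau=t,\dots,T-\delta t}}\mathbb E\Big[\sum_{\tau=t}^{T-\delta t}j_\tau(X_\tau,u_\tau)\,\delta t+J_T(X_T)\,\Big|\,X_t=X\Big],$$ which satisfies the Bellman equation $H(t,X)=\inf_{u\in\mathbb R}\{j_t(X,u)\delta t+\mathbb E[H(t+\delta t,X_{t+\delta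 t})\mid X_t=X,u_t=u]\}$. The optimal control is the one attaining the infimum.
   Formalization: The formal theorem assumes g_t > 0 at every step t < T, which the statement leaves implicit: if g_t < 0 with a_t > 0 the infimum is minus infinity, and if g_t = 0 the formulas for k_t and f_t are undefined. *)

(* Defs.v *)
From HB Require Import structures.
From mathcomp Require Export all_boot all_order all_algebra.
From mathcomp Require Export all_classical all_reals all_analysis.
Export Order.TTheory GRing.Theory Num.Theory.
Export numFieldNormedType.Exports.

Set Implicit Arguments.
Unset Strict Implicit.
Unset Printing Implicit Defensive.

Local Open Scope classical_set_scope.
Local Open Scope ring_scope.

(* The time grid 0, dt, ..., nsteps * dt = T is indexed by t : nat, and a
   coefficient at index t is its value at time t * dt.  Only the values at
   t < nsteps are used. *)

Section LinearAlgebra.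
Context {R : realType}.

Definition vec2 (x y : R) : 'cV[R]_2 := \col_i (if i == 0 then x else y).
Definition diag2 (x y : R) : 'M[R]_2 := diag_mx (vec2 x y)^T.
Definition e1 : 'cV[R]_2 := vec2 1 0.
Definition J1 : 'M[R]_2 := diag2 1 0.

Definition dot (x y : 'cV[R]_2) : R := (x^T *m y) 0 0.
Definition qform (M : 'M[R]_2) (x : 'cV[R]_2) : R := (x^T *m M *m x) 0 0.

End LinearAlgebra.

Record execution_problem (R : realType) := ExecutionProblem {
  nsteps : nat;
  dt : R;
  init_qty : R;               (* $Q_0$ *)
  volume : nat -> R;          (* $v_t$ *)
  temp_impact : nat -> R;     (* $\eta_t$ *)
  perm_impact : nat -> R;     (* $\mu_t$ *)
  half_spread : nat -> R;     (* $s_t$ *)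
  mean_rev : nat -> R;        (* $\kappa_t$ *)
  urgency : nat -> R;         (* $\beta_t$ *)
  terminal_penalty : R;       (* $\tilde\beta_T$ *)
  volatility : nat -> R       (* $\sigma_{t,\delta t}$ *)
}.

Section Dynamics.
Context {R : realType} (m : execution_problem R).

Definition vol_ratio (t : nat) : R := volume m t / init_qty m.
Definition impact (t : nat) : 'cV[R]_2 := vec2 (init_qty m * perm_impact m t) (-1).

Definition price (x : 'cV[R]_2) : R := x 0 0.
Definition remaining (x : 'cV[R]_2) : R := x 1 0.

Definition next_state (t : nat) (x : 'cV[R]_2) (u z : R) : 'cV[R]_2 :=
  diag2 (1 - mean_rev m t * dt m) 1 *m x
  + (vol_ratio t * u * dt m) *: impact t
  + vec2 (volatility m t * z) 0.

Fixpoint state_after (t : nat) (x : 'cV[R]_2) (u z : nat -> R) (n : nat)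
    : 'cV[R]_2 :=
  if n is n'.+1
  then next_state (t + n')%N (state_after t x u z n') (u (t + n')%N) (z (t + n')%N)
  else x.

(* Meaningful for t <= tau: the state at tau of the system started from x
   at t. *)
Definition state (t : nat) (x : 'cV[R]_2) (u z : nat -> R) (tau : nat)
    : 'cV[R]_2 := state_after t x u z (tau - t).

Definition stage_cost (t : nat) (x : 'cV[R]_2) (u : R) : R :=
  vol_ratio t * temp_impact m t * u ^+ 2
  + vol_ratio t * (price x + half_spread m t) * u
  + urgency m t * remaining x ^+ 2.

Definition terminal_cost (x : 'cV[R]_2) : R :=
  terminal_penalty m * remaining x ^+ 2.

Definition total_cost (t : nat) (x : 'cV[R]_2) (u z : nat -> R) : R :=
  \sum_(t <= tau < nsteps m) stage_cost tau (state t x u z tau) (u tau) * dt m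
  + terminal_cost (state t x u z (nsteps m)).

End Dynamics.

Section Noise.
Context {d : measure_display} {T : measurableType d} {R : realType}
        {P : probability T R}.
Implicit Type z : nat -> {RV P >-> R}.

Definition standard_normal (X : {RV P >-> R}) : Prop :=
  forall B : set R, measurable B -> distribution P X B = normal_prob 0 1 B.

Definition mutually_independent (n : nat) z : Prop :=
  forall (I : {set 'I_n}) (B : 'I_n -> set R),
    (forall i, measurable (B i)) ->
    P (\bigcap_(i in [set` I]) (z i @^-1` B i))
    = (\prod_(i in I) P (z i @^-1` B i))%E.

Definition iid_standard_normal (n : nat) z : Prop :=
  (forall i, (i < n)%N -> standard_normal (z i)) /\ mutually_independent n z.

(* Information available at t, before $z_t$ is drawn: the sigma-algebra
   generated by z_0, ..., z_(t-1). *)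
Definition past z (t : nat) : set (set T) :=
  g_sigma_preimage (fun i : 'I_t => (z i : T -> R)).

Definition measurable_wrt (F : set (set T)) (f : T -> R) : Prop :=
  forall B : set R, measurable B -> F (f @^-1` B).

End Noise.

Section Control.
Context {d : measure_display} {T : measurableType d} {R : realType}
        {P : probability T R}.
Variables (m : execution_problem R) (z : nat -> {RV P >-> R}).
Implicit Type u : nat -> T -> R.

(* Controls on the steps t, ..., nsteps - 1: non-anticipative, and square
   integrable so that the cost, which has no sign, is integrable. *)
Definition admissible (t : nat) u : Prop :=
  forall tau, (t <= tau < nsteps m)%N ->
    measurable_wrt (past z tau) (u tau) /\ u tau \in Lfun P 2%:E.

Definition controlled_state (t : nat) (x : 'cV[R]_2) u (tau : nat) (w : T)
    : 'cV[R]_2 := state m t x (u ^~ w) (fun i => z i w) tau.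

Definition expected_cost (t : nat) (x : 'cV[R]_2) u : \bar R :=
  'E_P[fun w => total_cost m t x (u ^~ w) (fun i => z i w)]%E.

(* The conditional expectation given X_t = x is the expectation for the system
   started from the deterministic state x at t. *)
Definition value (t : nat) (x : 'cV[R]_2) : \bar R :=
  ereal_inf [set expected_cost t x u | u in [set u | admissible t u]].

Definition optimal (t : nat) (x : 'cV[R]_2) u : Prop :=
  admissible t u /\ expected_cost t x u = value t x.

End Control.

Section BackwardScheme.
Context {R : realType} (m : execution_problem R).

(* Formulas for $g_t$, $k_t$, $f_t$, $P_t$, $b_t$, $e_t$ in terms of
   Q = $P_{t+\delta t}$, c = $b_{t+\delta t}$, h = $e_{t+\delta t}$. *)
Definition g_of (t : nat) (Q : 'M[R]_2) : R :=
  temp_impact m t + vol_ratio m t * qform Q (impact m t) * dt m.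

Definition k_of (t : nat) (Q : 'M[R]_2) : 'cV[R]_2 :=
  - (g_of t Q)^-1 *:
    ((1%:M - (mean_rev m t * dt m) *: J1) *m Q^T *m impact m t + 2^-1 *: e1).

Definition f_of (t : nat) (Q : 'M[R]_2) (c : 'cV[R]_2) : R :=
  - ((dot c (impact m t) + half_spread m t) / (2 * g_of t Q)).

Definition P_of (t : nat) (Q : 'M[R]_2) : 'M[R]_2 :=
  Q - (mean_rev m t * dt m) *: (J1 *m Q + Q *m J1)
  + (mean_rev m t ^+ 2 * dt m ^+ 2) *: (J1 *m Q *m J1)
  + dt m *: (diag2 0 (urgency m t)
             - (vol_ratio m t * g_of t Q) *: (k_of t Q *m (k_of t Q)^T)).

Definition b_of (t : nat) (Q : 'M[R]_2) (c : 'cV[R]_2) : 'cV[R]_2 :=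
  c - dt m *: ((2 * vol_ratio m t * g_of t Q * f_of t Q c) *: k_of t Q
               + mean_rev m t *: (J1 *m c)).

Definition e_of (t : nat) (Q : 'M[R]_2) (c : 'cV[R]_2) (h : R) : R :=
  h + volatility m t ^+ 2 * qform Q e1
  - vol_ratio m t * g_of t Q * f_of t Q c ^+ 2 * dt m.

(* Indexed by the number n of steps left: the coefficients at nsteps - n. *)
Fixpoint coefs (n : nat) : 'M[R]_2 * 'cV[R]_2 * R :=
  if n is n'.+1 then
    let t := (nsteps m - n)%N in
    let: (Q, c, h) := coefs n' in
    (P_of t Q, b_of t Q c, e_of t Q c h)
  else (diag2 0 (terminal_penalty m), 0, 0).

Definition Pmat (t : nat) : 'M[R]_2 := (coefs (nsteps m - t)).1.1.
Definition bvec (t : nat) : 'cV[R]_2 := (coefs (nsteps m - t)).1.2.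
Definition econst (t : nat) : R := (coefs (nsteps m - t)).2.

Definition gcoef (t : nat) : R := g_of t (Pmat t.+1).
Definition kgain (t : nat) : 'cV[R]_2 := k_of t (Pmat t.+1).
Definition foffset (t : nat) : R := f_of t (Pmat t.+1) (bvec t.+1).

End BackwardScheme.

(* Main.v *)
(* Write V_t(x) for the quadratic function with the coefficients of the backward scheme.
   Completing the square in the Bellman equation gives, pathwise,
     j_t(x,u) dt + V_{t+1}(next state)
       = V_t(x) + a_t g_t dt (u - k_t.x - f_t)^2 + noise,
   where the noise is sigma z_t times an affine function of (x, u) plus a multiple of
   z_t^2 - 1.  Summed along a trajectory the V's telescope.  For an admissible control,
   the factor of z_t is square integrable and depends on the past only, hence is
   independent of z_t, so the noise has mean zero and the expected cost is V_t(x) plus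
   the weighted mean squares of the deviations from the feedback k_t.x + f_t. *)
From HB Require Import structures.
Require Import Defs.
From mathcomp Require Import measurable_realfun ring.

Set Implicit Arguments.
Unset Strict Implicit.
Unset Printing Implicit Defensive.

Local Open Scope classical_set_scope.
Local Open Scope ring_scope.

(** * The standard normal law: density, symmetry, second moment *)

Section standard_normal_moments.
Context {R : realType}.
Local Notation mu := (@lebesgue_measure R).
Local Notation phi := (@normal_pdf R 0 1).
Local Notation N01 := (@normal_prob R 0 1).

Lemma std_normal_pdfE x : phi x = normal_peak 1 * expR (- (x ^+ 2) / 2).
Proof. by rewrite normal_pdfE// /normal_fun subr0 expr1n. Qed.

Lemma std_normal_pdfN x : phi (- x) = phi x.
Proof. by rewrite !std_normal_pdfE sqrrN. Qed.

(** The Radon-Nikodym derivative of the law and [phi] have the same integral over every measurable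
    set, so they agree almost everywhere. *)
Lemma ge0_integral_std_normal (f : R -> \bar R) :
  measurable_fun [set: R] f -> (forall x, 0 <= f x)%E ->
  (\int[N01]_x f x = \int[mu]_x (f x * (phi x)%:E))%E.
Proof.
move=> mf f0.
have dom := @normal_prob_dominates R 0 1.
rewrite -(Radon_Nikodym_SigmaFinite.change_of_variables dom)//.
have mF : measurable_fun [set: R] (Radon_Nikodym_SigmaFinite.f N01 mu).
  by apply: (measurable_int mu); exact: Radon_Nikodym_SigmaFinite.f_integrable.
have mphi : measurable_fun [set: R] (fun x => (phi x)%:E).
  by apply/measurable_EFinP; exact: measurable_normal_pdf.
apply: ae_eq_integral => //; [exact: emeasurable_funM|exact: emeasurable_funM|].
apply: ae_eqe_mul2l; apply: integral_ae_eq => //.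
  exact: Radon_Nikodym_SigmaFinite.f_integrable.
by move=> E _ mE; rewrite -Radon_Nikodym_SigmaFinite.f_integral.
Qed.

(** Both the density and Lebesgue measure are invariant under negation. *)
Lemma ge0_integral_std_normalN (f : R -> \bar R) :
  measurable_fun [set: R] f -> (forall x, 0 <= f x)%E ->
  (\int[N01]_x f (- x)%R = \int[N01]_x f x)%E.
Proof.
move=> mf f0; have mN : measurable_fun [set: R] (-%R : R -> R) by [].
have mfphi : measurable_fun [set: R] (fun x => f x * (phi x)%:E)%E.
  by apply: emeasurable_funM => //; apply/measurable_EFinP; exact: measurable_normal_pdf.
rewrite !ge0_integral_std_normal//; last exact: measurableT_comp.
transitivity (\int[pushforward mu (-%R : R -> measurableTypeR R)]_x (f x * (phi x)%:E))%E.
  rewrite ge0_integral_pushforward; [|exact: mN|exact: measurableT|exact: mfphi|].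
    by apply: eq_integral => x _; rewrite -[in LHS]std_normal_pdfN.
  by move=> x _; rewrite mule_ge0// lee_fin normal_pdf_ge0.
by apply: eq_measure_integral => A mA _; exact: lebesgue_measureN.
Qed.

Lemma is_derive_std_normal_pdf (x : R) : is_derive x 1 phi (- x * phi x).
Proof.
rewrite std_normal_pdfE
  (_ : normal_pdf _ _ = fun y => normal_peak 1 * expR (- (y ^+ 2) / 2)); last first.
  by apply/funext => y; exact: std_normal_pdfE.
apply: is_derive_eq; rewrite /GRing.scale/=; by field.
Qed.

(* [- x phi(x)] is a primitive of [(x^2 - 1) phi(x)] that vanishes at 0 and at
   infinity, so [x^2 phi(x)] and [phi(x)] have the same integral. *)
Let F (x : R) := - x * phi x.

Let is_derive_F (x : R) : is_derive x 1 F ((x ^+ 2 - 1) * phi x).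
Proof.
have H := is_derive_std_normal_pdf x.
apply: is_derive_eq; rewrite /GRing.scale/=; ring.
Qed.

Let integral_F (n : nat) :
  (\int[mu]_(x in `[0%R, n.+1%:R]) ((x ^+ 2 - 1) * phi x)%:E = (F n.+1%:R)%:E)%E.
Proof.
have cF : continuous F.
  by move=> x; apply/differentiable_continuous/derivable1_diffP; have [] := is_derive_F x.
rewrite (@continuous_FTC2 _ _ F)//.
- by rewrite /F oppr0 mul0r sube0.
- apply: continuous_subspaceT => x; apply: cvgM; last exact: continuous_normal_pdf.
  by apply: cvgB; [exact: exprn_continuous|exact: cvg_cst].
- split; [|exact/cvg_at_right_filter/cF|exact/cvg_at_left_filter/cF].
  by move=> x _; have [] := is_derive_F x.
- by move=> x _; rewrite derive1E; apply: derive_val.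
Qed.

(** From exp(y^2/2) >= y^2/2 one gets y phi(y) <= 2c/y, with c the peak of the density; at y = n+1
    this bound is a multiple of [harmonic]. *)
Let cvg_F : F n.+1%:R @[n --> \oo] --> (0 : R).
Proof.
have c0 : 0 <= normal_peak 1 :> R by exact: normal_peak_ge0.
apply: (@squeeze_cvgr _ _ _ _ (fun n => - (2 * normal_peak 1) * harmonic n) (cst 0)).
- apply: nearW => n; rewrite /F std_normal_pdfE /harmonic /=.
  have n0 : (0 : R) < n.+1%:R by [].
  move: (n.+1%:R : R) n0 => y y0.
  have e0 := expR_gt0 (y ^+ 2 / 2).
  have ylee : y ^+ 2 / 2 <= expR (y ^+ 2 / 2).
    by rewrite (le_trans _ (expR_ge1Dx _))// lerDr.
  have {}ylee : expR (- (y ^+ 2 / 2)) <= 2 / y ^+ 2.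
    by rewrite expRN -[leRHS]invf_div lef_pV2// posrE divr_gt0// exprn_gt0.
  rewrite !mulNr lerN2 oppr_le0; apply/andP; split; last first.
    by rewrite !mulr_ge0 ?expR_ge0// ltW.
  have -> : 2 * normal_peak 1 / y = normal_peak 1 * (y * (2 / y ^+ 2)).
    by field; rewrite gt_eqF.
  by rewrite [leLHS]mulrCA ler_wpM2l// ler_wpM2l// ltW.
- by rewrite -[X in _ --> X](mulr0 (- (2 * normal_peak 1))); apply: cvgMr; exact: cvg_harmonic.
- exact: cvg_cst.
Qed.

Let phi_ge0 (x : R) : 0 <= phi x. Proof. exact: normal_pdf_ge0. Qed.
Let mphi : measurable_fun [set: R] phi. Proof. exact: measurable_normal_pdf. Qed.

Let sqrphi (x : R) : R := x ^+ 2 * phi x.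
Let sqrphi_ge0 (x : R) : 0 <= sqrphi x.
Proof. by rewrite mulr_ge0 ?sqr_ge0. Qed.
Let msqrphi : measurable_fun [set: R] sqrphi.
Proof. by apply: measurable_funM => //; exact: measurable_funX. Qed.

(** Limit of [integral_F] along the intervals [0, n+1]; the boundary term vanishes by [cvg_F]. *)
Let integral_half : (\int[mu]_(x in `[0%R, +oo[) (sqrphi x)%:E
  = \int[mu]_(x in `[0%R, +oo[) (phi x)%:E)%E.
Proof.
have := @ge0_cvgn_integral R mu _ phi_ge0 mphi; rewrite -cvg_shiftS => cphi.
have := @ge0_cvgn_integral R mu _ sqrphi_ge0 msqrphi; rewrite -cvg_shiftS => csqr.
have cphi_ : continuous phi by exact: continuous_normal_pdf.
have sE n : (\int[mu]_(x in `[0%R, n.+1%:R]) (sqrphi x)%:E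
    = (F n.+1%:R)%:E + \int[mu]_(x in `[0%R, n.+1%:R]) (phi x)%:E)%E.
  rewrite -integral_F -integralD//.
  - by apply: eq_integral => x _; rewrite -EFinD /sqrphi; congr EFin; ring.
  - apply: continuous_compact_integrable; first exact: segment_compact.
    apply: continuous_subspaceT => x; apply: cvgM; last exact: cphi_.
    by apply: cvgB; [exact: exprn_continuous|exact: cvg_cst].
  - apply: continuous_compact_integrable; first exact: segment_compact.
    exact: continuous_subspaceT.
have csum : ((F n.+1%:R)%:E + \int[mu]_(x in `[0%R, n.+1%:R]) (phi x)%:E)%E
    @[n --> \oo] --> (\int[mu]_(x in `[0%R, +oo[) (phi x)%:E)%E.
  rewrite -[X in _ --> X]add0e; apply: cvgeD => //.
  by apply: cvg_EFin => //; exact: nearW.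
move: csum; rewrite -(eq_cvg _ _ sE) => csum.
exact: (cvg_unique _ csqr csum).
Qed.

(** Evenness reduces the integral to the half-line, where [integral_half] replaces x^2 phi(x) by
    phi(x); the density has total mass 1. *)
Lemma integral_std_normal_sqr : (\int[N01]_x (x ^+ 2)%:E = 1)%E.
Proof.
rewrite ge0_integral_std_normal//; last 2 first.
- by apply/measurable_EFinP; exact: measurable_funX.
- by move=> x; rewrite lee_fin sqr_ge0.
have itv0y : [set x | 0 <= x]%R = `[0, +oo[%classic :> set R.
  by apply/seteqP; split => x/=; rewrite in_itv/= andbT.
transitivity (\int[mu]_x (sqrphi x)%:E)%E; first by apply: eq_integral => x _; rewrite EFinM.
rewrite ge0_symfun_integralT//; last 2 first.
- by move=> x; apply: cvgM; [exact: exprn_continuous|exact: continuous_normal_pdf].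
- by move=> x; rewrite /sqrphi /= sqrrN std_normal_pdfN.
rewrite itv0y integral_half -itv0y -ge0_symfun_integralT//.
- exact: integral_normal_pdf.
- exact: continuous_normal_pdf.
- by move=> x /=; rewrite std_normal_pdfN.
Qed.

End standard_normal_moments.

(** * Independence of the noise from the past, and factorization of expectations *)

Section independence.
Context {d : measure_display} {T : measurableType d} {R : realType}
        {P : probability T R}.

(** Dynkin's argument: both sides are finite measures in [A] that agree on the cylinders over z_0,
    ..., z_(t-1), a pi-system generating the past. *)
Lemma past_independent (n : nat) (z : nat -> {RV P >-> R}) (t : nat)
    (A : set T) (B : set R) :
  mutually_independent n z -> (t < n)%N -> past z t A -> measurable B ->
  P (A `&` z t @^-1` B) = (P A * P (z t @^-1` B))%E.
Proof.
move=> indep tn pastA mB.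
have mzt C i : measurable C -> measurable (z i @^-1` C).
  by move=> mC; rewrite -[X in measurable X]setTI; exact: measurable_funP.
pose cyl (C : nat -> set R) : set T := \bigcap_(i in `I_t) (z i @^-1` C i).
pose G : set (set T) := [set cyl C | C in [set C | forall i, measurable (C i)]].
have mG : G `<=` measurable.
  by move=> _ [C mC <-]; apply: fin_bigcap_measurable => // i _; exact: mzt.
have indepG C : (forall i, measurable (C i)) ->
    P (cyl C `&` z t @^-1` B) = (P (cyl C) * P (z t @^-1` B))%E.
  move=> mC.
  pose I := [set i : 'I_n | (i < t)%N]%SET.
  have IE (D : nat -> set R) : \bigcap_(i in [set` I]) (z i @^-1` D i) = cyl D.
    apply/seteqP; split => w /= h i /= it.
      by apply: (h (Ordinal (ltn_trans it tn))) => /=; rewrite inE.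
    by apply: h; move: it; rewrite /= inE.
  (* Cylinders do not see coordinate [t], so placing [B] there lets one family of sets serve both
     for [I] and for [I] with [t] added. *)
  pose D i := if i == t then B else C i.
  have mD i : measurable (D i) by rewrite /D; case: ifP.
  have -> : cyl C = cyl D.
    by apply: eq_bigcapr => i /= it; rewrite /D ltn_eqF.
  have BE : B = D t by rewrite /D eqxx.
  have tI : Ordinal tn \notin I by rewrite /I inE /= ltnn.
  have := indep (Ordinal tn |: I)%SET (fun i => D i) (fun i => mD i).
  rewrite big_setU1//= -(indep I (fun i => D i) (fun i => mD i)) IE => E.
  rewrite BE muleC -E setIC; congr (P _).
  apply/seteqP; split => w.
    move=> [wt wI] i /=; rewrite !inE => /orP[/eqP ->//|it]; exact: wI.
  move=> wI; split; first by apply: (wI (Ordinal tn)); rewrite /= setU11.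
  by move=> i /= it; apply: (wI (Ordinal (ltn_trans it tn))); rewrite /= !inE /= it orbT.
have sub : past z t `<=` <<s G >>.
  apply: smallest_sub; first exact: smallest_sigma_algebra.
  rewrite -bigcup_seq => C [i _ [D mD <-]]; apply: sub_sigma_algebra.
  (* A generator of the past is the cylinder whose other factors are all full. *)
  exists (fun j => if j == i :> nat then D else setT).
    by move=> j /=; case: ifP.
  apply/seteqP; split => w.
    by move=> /(_ i (ltn_ord i)) /=; rewrite eqxx.
  by move=> [_ Dw] j /= _; case: eqP => [->|].
have mD := mzt B t mB.
have sA := sub _ pastA.
(* The uniqueness theorem compares measures: the left side becomes a restriction of [P], the right
   side a multiple of [P] by a finite constant. *)
rewrite muleC -[LHS]/(mrestr P mD A).
have fineE : P (z t @^-1` B) = (fine (P (z t @^-1` B)))%:E by rewrite fineK// fin_num_measure.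
rewrite fineE -[RHS]/(mscale (NngNum (fine_ge0 (measure_ge0 P (z t @^-1` B)))) P A).
have TG : G setT.
  exists (fun=> setT) => //; apply/seteqP; split => // w _ i _ //.
apply: (@g_sigma_algebra_measure_unique _ R T G mG (fun=> setT)) => //.
- by rewrite bigcup_const.
- move=> _ _ [C mC <-] [C' mC' <-]; exists (fun i => C i `&` C' i).
    by move=> i; exact: measurableI.
  by rewrite /cyl -bigcapI; apply: eq_bigcapr => i _; rewrite preimage_setI.
- move=> _ [C mC <-]; rewrite /= /mscale/= /mrestr -fineE muleC; exact: indepG.
- by move=> _; rewrite (le_lt_trans (probability_le1 _ _))// ?ltry// setTI.
Qed.

(* Independence identifies the law of [(X, Z)] with the product of the two laws;
   Fubini then factors the integral. *)
Lemma expectationM_indep (X : T -> R) (Z : {RV P >-> R}) :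
  X \in Lfun P 2%:E -> (Z : T -> R) \in Lfun P 2%:E ->
  (forall A B, measurable A -> measurable B ->
    P (X @^-1` A `&` Z @^-1` B) = (P (X @^-1` A) * P (Z @^-1` B))%E) ->
  ('E_P[X \* Z] = 'E_P[X] * 'E_P[Z])%E.
Proof.
move=> X2 Z2 indep.
have mX : measurable_fun setT X by move: X2 => /[!inE]/andP[/[!inE]].
pose X' : {RV P >-> R} := HB.pack X (isMeasurableFun.Build _ _ _ _ X mX).
have mW : measurable_fun setT (fun w => (X w, Z w)) by exact: measurable_fun_pair.
pose W : {mfun T >-> (R * R)%type} := HB.pack (fun w => (X w, Z w))
  (isMeasurableFun.Build _ _ _ _ _ mW).
have mM : measurable_fun [set: R * R] (fun p : R * R => (p.1 * p.2)%:E).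
  by apply/measurable_EFinP; apply: measurable_funM.
have WE A : measurable A -> distribution P W A = (distribution P X' \x distribution P Z)%E A.
  by move=> mA; apply/esym; apply: product_measure_unique.
have intXZ : P.-integrable setT (EFin \o (X \* Z)).
  by apply/Lfun1_integrable/Lfun2_mul_Lfun1.
have int1 Y : Y \in Lfun P 2%:E -> P.-integrable setT (EFin \o Y).
  by move=> Y2; apply/Lfun1_integrable; apply: Lfun_subset12 => //; rewrite fin_num_measure.
(* Integrability passes from the joint law to the product law, where Fubini will use it. *)
have intW : (distribution P X' \x distribution P Z)%E.-integrable [set: R * R]
    (fun p : R * R => (p.1 * p.2)%:E).
  have /integrableP[_ ?] : (distribution P W).-integrable [set: R * R]
      (fun p : R * R => (p.1 * p.2)%:E).
    by apply: integrable_pushforward.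
  apply/integrableP; split => //.
  by rewrite (@eq_measure_integral _ _ _ _ (distribution P W))// => A mA _; exact/esym/WE.
rewrite unlock.
transitivity (\int[distribution P W]_p (p.1 * p.2)%:E)%E.
  by rewrite integral_distribution.
rewrite (@eq_measure_integral _ _ _ _ (distribution P X' \x distribution P Z)%E); last first.
  by move=> A mA _; exact: WE.
rewrite -(integral12_prod_meas1 intW) /fubini_F /=.
have EX : (\int[distribution P X']_x x%:E = \int[P]_w (X w)%:E)%E.
  by rewrite integral_distribution//; exact: int1.
have EZ : (\int[distribution P Z]_x x%:E = \int[P]_w (Z w)%:E)%E.
  by rewrite integral_distribution//; exact: int1.
have mE : measurable_fun [set: R] (fun x : R => x%:E).
  by apply/measurable_EFinP; exact: measurable_id.
have iX : (distribution P X').-integrable [set: R] (fun x : R => x%:E).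
  apply: (integrable_pushforward (measurable_funPT _)) => //.
  exact: int1.
have iZ : (distribution P Z).-integrable [set: R] (fun x : R => x%:E).
  apply: (integrable_pushforward (measurable_funPT _)) => //.
  exact: int1.
rewrite -EX -EZ.
under eq_integral do (under eq_integral do rewrite EFinM; rewrite integralZl//).
rewrite -(fineK (integrable_fin_num measurableT iZ)).
by rewrite integralZr.
Qed.

End independence.

(** * Coordinates in dimension two *)

Section vec2.
Context {R : realType}.
Implicit Types (x y : 'cV[R]_2) (M : 'M[R]_2).

Lemma sum_ord2 (V : nmodType) (F : 'I_2 -> V) : \sum_i F i = F 0 + F 1.
Proof. by rewrite !big_ord_recl big_ord0 addr0; congr (F _ + F _); exact/val_inj. Qed.

Lemma dotE x y : dot x y = x 0 0 * y 0 0 + x 1 0 * y 1 0.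
Proof. by rewrite /dot mxE sum_ord2 !mxE. Qed.

Lemma mulmxE2 M x i : (M *m x) i 0 = M i 0 * x 0 0 + M i 1 * x 1 0.
Proof. by rewrite mxE sum_ord2. Qed.

Lemma qformE M x : qform M x =
  (x 0 0 * M 0 0 + x 1 0 * M 1 0) * x 0 0 + (x 0 0 * M 0 1 + x 1 0 * M 1 1) * x 1 0.
Proof. by rewrite /qform !mxE sum_ord2 !mxE !sum_ord2 !mxE. Qed.

Lemma diag2E a b i j : diag2 a b i j = (if i == 0 then a else b : R) *+ (i == j).
Proof. by rewrite /diag2 !mxE; have [->|] := eqVneq i j. Qed.

End vec2.

Lemma ord2P (i : 'I_2) : i = 0 \/ i = 1.
Proof. by case: i => [[|[|//]] ?]; [left|right]; exact/val_inj. Qed.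

(** * Completing the square in the Bellman equation *)

Section bellman.
Context {R : realType} (m : execution_problem R).
Implicit Types (Q : 'M[R]_2) (c x : 'cV[R]_2).

(** Symmetry merges the cross terms of the quadratic form in [bellman_step], so it must survive the
    backward recursion. *)
Lemma P_of_sym t Q : Q 1 0 = Q 0 1 -> P_of m t Q 1 0 = P_of m t Q 0 1.
Proof.
move=> sQ; rewrite /P_of /J1.
(* The identity holds for arbitrary [g] and [k], since k k^T is symmetric. *)
move: (g_of m t Q) (k_of m t Q) => g k.
rewrite !(mxE, sum_ord2, big_ord1) /= !sQ; ring.
Qed.

Lemma coefs_sym n : (coefs m n).1.1 1 0 = (coefs m n).1.1 0 1.
Proof.
elim: n => [|n IH] /=; first by rewrite !diag2E.
by move: IH; case: (coefs m n) => [[Q c] h] /= /P_of_sym.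
Qed.

Lemma next_stateE t x u z i :
  next_state m t x u z i 0
  = (if i == 0 then 1 - mean_rev m t * dt m else 1) * x i 0
    + vol_ratio m t * u * dt m * impact m t i 0
    + (if i == 0 then volatility m t * z else 0).
Proof.
rewrite /next_state; move: (impact m t) => w.
rewrite !(mxE, sum_ord2).
by case: (ord2P i) => -> /=; ring.
Qed.

(* Completing the square in [u]; the last two terms are the only ones that depend
   on [z], and they average out. *)
Lemma bellman_step t Q c h x u z : Q 1 0 = Q 0 1 -> g_of m t Q != 0 ->
  let y := next_state m t x u 0 in
  stage_cost m t x u * dt m
  + (qform Q (next_state m t x u z) + dot c (next_state m t x u z) + h)
  = (qform (P_of m t Q) x + dot (b_of m t Q c) x + e_of m t Q c h)
  + (vol_ratio m t * g_of m t Q * dt m * (u - (dot (k_of m t Q) x + f_of m t Q c)) ^+ 2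
  + (volatility m t * z * (2 * (Q *m y) 0 0 + c 0 0)
  + volatility m t ^+ 2 * Q 0 0 * (z ^+ 2 - 1))).
Proof.
move=> sQ g0 /=.
rewrite /stage_cost /price /remaining /e_of.
(* Trading the temporary impact for [g] makes [g] an atom, the only denominator apart from numerals
   once [k] and [f] are expanded in coordinates. *)
have gE : temp_impact m t = g_of m t Q - vol_ratio m t * qform Q (impact m t) * dt m.
  by rewrite addrK.
have kE0 : k_of m t Q 0 0 = - (g_of m t Q)^-1 * ((1 - mean_rev m t * dt m) *
   (Q 0 0 * impact m t 0 0 + Q 0 1 * impact m t 1 0) + 2^-1).
  rewrite /k_of; move: (g_of m t Q) (impact m t) => g w.
  rewrite !(mxE, sum_ord2, big_ord1) /= !sQ; ring.
have kE1 : k_of m t Q 1 0 = - (g_of m t Q)^-1 * (Q 0 1 * impact m t 0 0 + Q 1 1 * impact m t 1 0).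
  rewrite /k_of; move: (g_of m t Q) (impact m t) => g w.
  rewrite !(mxE, sum_ord2, big_ord1) /= !sQ; ring.
have fE : f_of m t Q c = - ((c 0 0 * impact m t 0 0 + c 1 0 * impact m t 1 0
    + half_spread m t) / (2 * g_of m t Q)).
  by rewrite /f_of dotE.
rewrite /P_of /b_of !qformE !dotE mulmxE2.
rewrite !next_stateE /=.
rewrite gE qformE.
move: (g_of m t Q) (k_of m t Q) (impact m t) (f_of m t Q c) g0 gE kE0 kE1 fE.
move=> g k w f g0 gE kE0 kE1 fE.
rewrite !(mxE, sum_ord2, big_ord1) /= !sQ.
rewrite kE0 kE1 fE.
by field; rewrite g0.
Qed.

End bellman.

(** * Square integrability and moments of the noise *)

Section second_moments.
Context {d : measure_display} {T : measurableType d} {R : realType}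
        {P : probability T R}.

Lemma Lfun2_sqr_integrable (f : T -> R) : measurable_fun [set: T] f ->
  P.-integrable [set: T] (fun w => (f w ^+ 2)%:E) -> f \in Lfun P 2%:E.
Proof.
move=> mf /integrableP[_ intf]; rewrite inE; apply/andP; split; rewrite inE//=.
rewrite /finite_norm unlock /Lnorm; apply: poweR_lty.
rewrite (eq_integral (fun w => `|(f w ^+ 2)%:E|%E))// => w _.
by rewrite /= powR_mulrn// -normrX.
Qed.

Lemma Lfun2_sqr_Lfun1 (f : T -> R) : f \in Lfun P 2%:E ->
  (fun w => f w ^+ 2) \in Lfun P 1.
Proof. by move=> f2; apply/Lfun1_integrable; exact: Lfun2_integrable_sqr. Qed.

Lemma Lfun2_Lfun1 (f : T -> R) : f \in Lfun P 2%:E -> f \in Lfun P 1.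
Proof. by apply: Lfun_subset12; rewrite fin_num_measure. Qed.

(* The library's [normal_prob] lives on [measurableTypeR R], whose display is not
   that of [R]; the identity carries it over. *)
Let idR : measurableTypeR R -> R := idfun.

#[local] HB.instance Definition _ :=
  @isMeasurableFun.Build _ _ _ _ idR (@measurable_id _ _ setT).

Lemma ge0_integral_standard_normal (Z : {RV P >-> R}) (f : R -> \bar R) :
  standard_normal Z -> measurable_fun [set: R] f -> (forall x, 0 <= f x)%E ->
  (\int[P]_w f (Z w) = \int[normal_prob 0 1]_x f x)%E.
Proof.
move=> nZ mf f0.
transitivity (\int[distribution P Z]_x f x)%E.
  by rewrite ge0_integral_distribution.
transitivity (\int[pushforward (@normal_prob R 0 1) idR]_x f x)%E.
  by apply: eq_measure_integral => A mA _; exact: nZ.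
by rewrite ge0_integral_pushforward.
Qed.

Lemma standard_normal_sqr (Z : {RV P >-> R}) : standard_normal Z ->
  (\int[P]_w (Z w ^+ 2)%:E = 1)%E.
Proof.
move=> nZ; rewrite -integral_std_normal_sqr.
rewrite (ge0_integral_standard_normal (f := fun x => (x ^+ 2)%:E) nZ)//.
- by apply/measurable_EFinP; exact: measurable_funX.
- by move=> y; rewrite lee_fin sqr_ge0.
Qed.

Lemma standard_normal_Lfun2 (Z : {RV P >-> R}) : standard_normal Z ->
  (Z : T -> R) \in Lfun P 2%:E.
Proof.
move=> nZ; apply: Lfun2_sqr_integrable => //; apply/integrableP; split.
  by apply/measurable_EFinP; exact: measurable_funX.
under eq_integral do rewrite gee0_abs ?lee_fin ?sqr_ge0//.
by rewrite standard_normal_sqr// ltry.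
Qed.

(** By symmetry of the law, the positive and negative parts of [Z] have the same integral. It is
    finite because [Z] is square integrable, so the difference is 0 in the extended reals. *)
Lemma standard_normal_mean (Z : {RV P >-> R}) : standard_normal Z ->
  ('E_P[Z] = 0)%E.
Proof.
move=> nZ; have iZ := (Lfun1_integrable _ _).1 (Lfun2_Lfun1 (standard_normal_Lfun2 nZ)).
have mE : measurable_fun [set: R] (EFin : R -> \bar R).
  by apply/measurable_EFinP; exact: measurable_id.
have mpos : measurable_fun [set: R] ((EFin : R -> \bar R)^\+)%E by exact: measurable_funepos.
have mneg : measurable_fun [set: R] ((EFin : R -> \bar R)^\-)%E by exact: measurable_funeneg.
rewrite unlock integralE.
have -> : (\int[P]_w ((EFin \o Z)^\- w) = \int[P]_w ((EFin \o Z)^\+ w))%E.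
  transitivity (\int[normal_prob 0 1]_x ((EFin : R -> \bar R)^\- x))%E.
    rewrite -(ge0_integral_standard_normal nZ mneg); last exact: funeneg_ge0.
    by apply: eq_integral => w _; rewrite !funenegE.
  transitivity (\int[normal_prob 0 1]_x ((EFin : R -> \bar R)^\+ x))%E.
    rewrite -[RHS]ge0_integral_std_normalN; [|exact: mpos|exact: funepos_ge0].
    by apply: eq_integral => x _; rewrite funenegE funeposE.
  rewrite -(ge0_integral_standard_normal nZ mpos); last exact: funepos_ge0.
  by apply: eq_integral => w _; rewrite !funeposE.
by rewrite subee// integrable_fin_num//; exact: integrable_funepos.
Qed.

End second_moments.

(** * Square-integrable functions of the past *)

Section adapted.
Context {d : measure_display} {T : measurableType d} {R : realType}
        {P : probability T R}.
Context (n : nat) (z : nat -> {RV P >-> R}).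
Implicit Types (t : nat) (f g : T -> R).

(** The class kept stable by the dynamics: measurability yields independence from z_t, and square
    integrability makes products with z_t integrable. *)
Definition adapted_L2 t f := measurable_wrt (past z t) f /\ f \in Lfun P 2%:E.

(** Gives access to the closure properties of measurable functions for the generated
    sigma-algebra. *)
Lemma measurable_wrtP (G : set (set T)) f :
  measurable_wrt <<s G >> f <->
  measurable_fun [set: g_sigma_algebraType G] (f : g_sigma_algebraType G -> R).
Proof.
split=> [mf _ B mB|mf B mB]; first by rewrite setTI; exact: mf.
by have := mf measurableT B mB; rewrite setTI.
Qed.

Lemma adapted_L2_cst t c : adapted_L2 t (fun=> c).
Proof.
split; first by apply/measurable_wrtP; exact: measurable_cst.
exact: Lfun_cst.
Qed.

Lemma adapted_L2D t f g : adapted_L2 t f -> adapted_L2 t g ->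
  adapted_L2 t (fun w => f w + g w).
Proof.
move=> [/measurable_wrtP mf f2] [/measurable_wrtP mg g2]; split.
  by apply/measurable_wrtP; exact: measurable_funD.
have p1 : (1 <= 2%:E :> \bar R)%E by rewrite lee1n.
exact: (Lfun_addr_closed P p1).2.
Qed.

Lemma adapted_L2Z t c f : adapted_L2 t f -> adapted_L2 t (fun w => c * f w).
Proof.
move=> [/measurable_wrtP mf f2]; split.
  by apply/measurable_wrtP; exact: measurable_funM.
have -> : (fun w => c * f w) = c \o* f by apply/funext => w /=; rewrite mulrC.
by apply: Lfun_scale => //; rewrite ler1n.
Qed.

Lemma past_gen t i B : (i < t)%N -> measurable B -> past z t (z i @^-1` B).
Proof.
move=> it mB; apply: sub_sigma_algebra; rewrite -bigcup_seq.
exists (Ordinal it); first by rewrite /= mem_index_enum.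
by exists B => //=; rewrite setTI.
Qed.

Lemma sub_past t t' : (t <= t')%N -> past z t `<=` past z t'.
Proof.
move=> tt'; apply: smallest_sub; first exact: smallest_sigma_algebra.
rewrite -bigcup_seq => _ [i _ [B mB <-]]; rewrite setTI.
by apply: past_gen => //; exact: (leq_trans (ltn_ord i)).
Qed.

Lemma adapted_L2S t f : adapted_L2 t f -> adapted_L2 t.+1 f.
Proof. by move=> [mf f2]; split=> // B mB; apply: (sub_past (leqnSn t)); exact: mf. Qed.

Lemma adapted_L2_noise t : standard_normal (z t) -> adapted_L2 t.+1 (z t).
Proof.
by move=> nz; split; [move=> B; exact: past_gen|exact: standard_normal_Lfun2].
Qed.

Lemma expectation_noiseM t f : iid_standard_normal n z -> (t < n)%N ->
  adapted_L2 t f -> ('E_P[f \* z t] = 0)%E.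
Proof.
move=> [nz indep] tn [mf f2].
rewrite expectationM_indep ?standard_normal_mean ?mule0//; [exact: nz| |].
  by apply: standard_normal_Lfun2; exact: nz.
move=> A B mA mB; apply: past_independent indep tn _ mB; exact: mf.
Qed.

End adapted.

(** * Pathwise decomposition of the cost *)

Section cost_decomposition.
Context {R : realType} (m : execution_problem R).

Definition quad_value t (x : 'cV[R]_2) : R :=
  qform (Pmat m t) x + dot (bvec m t) x + econst m t.

(** The [z]-dependent remainder of [bellman_step]. The inner [next_state] has zero noise, so the
    factor of [z] is a function of the current state and control alone. *)
Definition noise_step t (x : 'cV[R]_2) (u z : R) : R :=
  volatility m t * z * (2 * (Pmat m t.+1 *m next_state m t x u 0) 0 0 + bvec m t.+1 0 0)
  + volatility m t ^+ 2 * Pmat m t.+1 0 0 * (z ^+ 2 - 1).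

Definition deviation t (x : 'cV[R]_2) (u : R) : R :=
  u - (dot (kgain m t) x + foffset m t).

(** Converts the recursion on the number of steps left, internal to [coefs], into one on the time
    index. *)
Lemma coefs_step t : (t < nsteps m)%N ->
  [/\ Pmat m t = P_of m t (Pmat m t.+1),
      bvec m t = b_of m t (Pmat m t.+1) (bvec m t.+1) &
      econst m t = e_of m t (Pmat m t.+1) (bvec m t.+1) (econst m t.+1)].
Proof.
move=> tn; rewrite /Pmat /bvec /econst -(subnSK tn) /=.
by rewrite (subnSK tn) (subKn (ltnW tn)); case: (coefs m _) => [[]].
Qed.

Lemma stage_cost_step t x u z : (t < nsteps m)%N -> gcoef m t != 0 ->
  stage_cost m t x u * dt m + quad_value t.+1 (next_state m t x u z)
  = quad_value t x
    + (vol_ratio m t * gcoef m t * dt m * deviation t x u ^+ 2 + noise_step t x u z).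
Proof.
move=> tn g0; rewrite [quad_value t x]/quad_value; have [-> -> ->] := coefs_step tn.
exact: bellman_step (coefs_sym _ _) g0.
Qed.

Lemma stateS t x u z tau : (t <= tau)%N ->
  state m t x u z tau.+1 = next_state m tau (state m t x u z tau) (u tau) (z tau).
Proof. by move=> ttau; rewrite /state subSn//= subnKC. Qed.

Lemma state_id t x u z : state m t x u z t = x.
Proof. by rewrite /state subnn. Qed.

Lemma quad_value_terminal x : quad_value (nsteps m) x = terminal_cost m x.
Proof.
rewrite /quad_value /terminal_cost /remaining /Pmat /bvec /econst subnn /=.
by rewrite qformE dotE !diag2E !mxE /=; ring.
Qed.

Lemma total_costE t x u z : (t <= nsteps m)%N ->
  (forall tau, (tau < nsteps m)%N -> gcoef m tau != 0) ->
  total_cost m t x u z = quad_value t x + \sum_(t <= tau < nsteps m)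
    (vol_ratio m tau * gcoef m tau * dt m
       * deviation tau (state m t x u z tau) (u tau) ^+ 2
     + noise_step tau (state m t x u z tau) (u tau) (z tau)).
Proof.
move=> tn g0; pose X := state m t x u z; rewrite /total_cost -/X -quad_value_terminal.
(* Each stage cost is the decrease of [quad_value] plus [N], hence the sign; after telescoping, the
   value at [nsteps m] cancels the terminal cost. *)
pose V tau := - quad_value tau (X tau).
pose N tau := vol_ratio m tau * gcoef m tau * dt m * deviation tau (X tau) (u tau) ^+ 2
  + noise_step tau (X tau) (u tau) (z tau).
rewrite (eq_big_nat _ _ (F2 := fun tau => (V tau.+1 - V tau) + N tau)); last first.
  move=> tau /andP[ttau taun]; have := stage_cost_step (X tau) (u tau) (z tau) taun (g0 _ taun).
  rewrite -stateS// -/X /V /N => /(canRL (addrK _)) ->; ring.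
rewrite big_split/= telescope_sumr// /V /X state_id; ring.
Qed.

End cost_decomposition.

(** * Expected cost of admissible controls; the feedback control *)

Section controlled_cost.
Context {d : measure_display} {T : measurableType d} {R : realType}
        {P : probability T R}.
Context (m : execution_problem R) (z : nat -> {RV P >-> R}).
Local Notation adapted := (adapted_L2 z).

Definition adapted_state t (X : T -> 'cV[R]_2) : Prop :=
  forall i, adapted t (fun w => X w i 0).

Lemma adapted_dot t c X : adapted_state t X -> adapted t (fun w => dot c (X w)).
Proof.
move=> aX; under eq_fun do rewrite dotE.
by apply: adapted_L2D; apply: adapted_L2Z.
Qed.

(** The information time [s] is separate from the step [t]: it serves with s = t+1 for the true
    noise z_t, and with s = t for zero noise. *)
Lemma adapted_next_state s t (X : T -> 'cV[R]_2) (U Z : T -> R) :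
  adapted_state s X -> adapted s U -> adapted s Z ->
  adapted_state s (fun w => next_state m t (X w) (U w) (Z w)).
Proof.
move=> aX aU aZ i.
have -> : (fun w => next_state m t (X w) (U w) (Z w) i 0) = (fun w =>
    ((if i == 0 then 1 - mean_rev m t * dt m else 1) * X w i 0
    + (vol_ratio m t * dt m * impact m t i 0) * U w)
    + (if i == 0 then volatility m t else 0) * Z w).
  by apply/funext => w; rewrite next_stateE; case: ifP => _; ring.
by do 2?[apply: adapted_L2D]; apply: adapted_L2Z.
Qed.

Lemma adapted_controlled_state t x u tau :
  (forall i, (i < nsteps m)%N -> standard_normal (z i)) -> admissible m z t u ->
  (t <= tau <= nsteps m)%N -> adapted_state tau (controlled_state m z t x u tau).
Proof.
move=> nz adm; rewrite /controlled_state; elim: tau => [|tau IH] /andP[].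
  rewrite leqn0 => /eqP -> _ i.
  by under eq_fun do rewrite state_id; exact: adapted_L2_cst.
(* If t = tau+1, the trajectory is still at its deterministic starting point. *)
rewrite leq_eqVlt => /predU1P[-> _ i|].
  by under eq_fun do rewrite state_id; exact: adapted_L2_cst.
rewrite ltnS => ttau taun i; under eq_fun do rewrite stateS//.
apply: adapted_next_state.
- by move=> j; apply: adapted_L2S; apply: IH; rewrite ttau ltnW.
- by apply: adapted_L2S; apply: adm; rewrite ttau.
- by apply: adapted_L2_noise; exact: nz.
Qed.

Lemma adapted_deviation t (X : T -> 'cV[R]_2) (U : T -> R) : adapted_state t X -> adapted t U ->
  adapted t (fun w => deviation m t (X w) (U w)).
Proof.
move=> aX aU.
have -> : (fun w => deviation m t (X w) (U w)) =
    (fun w => U w + ((-1) * dot (kgain m t) (X w) + (- foffset m t))).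
  by apply/funext => w; rewrite /deviation; ring.
apply: adapted_L2D => //; apply: adapted_L2D; last exact: adapted_L2_cst.
by apply: adapted_L2Z; exact: adapted_dot.
Qed.

(** The step splits as [L] times z_t, with [L] adapted and hence independent of z_t, plus a multiple
    of z_t^2 - 1, centered because the variance is 1. *)
Lemma noise_step_centered t (X : T -> 'cV[R]_2) (U : T -> R) :
  iid_standard_normal (nsteps m) z -> (t < nsteps m)%N ->
  adapted_state t X -> adapted t U ->
  (fun w => noise_step m t (X w) (U w) (z t w)) \in Lfun P 1 /\
  ('E_P[fun w => noise_step m t (X w) (U w) (z t w)] = 0)%E.
Proof.
move=> zn tn aX aU; have nzt := zn.1 _ tn; have zt2 := standard_normal_Lfun2 nzt.
pose Q := Pmat m t.+1.
pose Y w := next_state m t (X w) (U w) 0.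
have aY : adapted_state t Y.
  by apply: adapted_next_state => //; exact: adapted_L2_cst.
pose L w := volatility m t * (2 * (Q 0 0 * Y w 0 0 + Q 0 1 * Y w 1 0) + bvec m t.+1 0 0).
have aL : adapted t L.
  apply: adapted_L2Z; apply: adapted_L2D; last exact: adapted_L2_cst.
  by apply: adapted_L2Z; apply: adapted_L2D; apply: adapted_L2Z.
pose S : T -> R := (fun w => z t w ^+ 2) \- cst 1.
have z1 := Lfun2_sqr_Lfun1 zt2.
have S1 : S \in Lfun P 1 by apply: rpredB => //; exact: Lfun_cst.
have ES : ('E_P[S] = 0)%E.
  rewrite expectationB ?expectation_cst//; last exact: Lfun_cst.
  by rewrite {1}unlock standard_normal_sqr// subee.
have -> : (fun w => noise_step m t (X w) (U w) (z t w))
    = (L \* z t) \+ ((volatility m t ^+ 2 * Q 0 0) \o* S).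
  by apply/funext => w; rewrite /noise_step mulmxE2 /= /L /S /Y /=; ring.
have Lz1 : L \* z t \in Lfun P 1 by apply: Lfun2_mul_Lfun1 => //; exact: aL.2.
have cS1 : (volatility m t ^+ 2 * Q 0 0) \o* S \in Lfun P 1 by exact: Lfun_scale.
split; first exact: rpredD.
by rewrite expectationD// expectationZl// ES mule0 adde0 (expectation_noiseM zn).
Qed.

Lemma expectation_sum_nat (F : nat -> T -> R) i j :
  (forall k, (i <= k < j)%N -> F k \in Lfun P 1) ->
  (fun w => \sum_(i <= k < j) F k w) \in Lfun P 1 /\
  'E_P[fun w => (\sum_(i <= k < j) F k w)%R]%E = (\sum_(i <= k < j) 'E_P[F k])%E.
Proof.
move=> F1; rewrite -fct_sumE; split.
  by rewrite big_nat; apply: rpred_sum.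
rewrite -(big_map F xpredT id) expectation_sum ?big_map// => f.
by move=> /mapP[k]; rewrite mem_index_iota => /F1 ? ->.
Qed.

Lemma expected_costE t x u : iid_standard_normal (nsteps m) z ->
  (forall tau, (tau < nsteps m)%N -> gcoef m tau != 0) ->
  (t <= nsteps m)%N -> admissible m z t u ->
  (expected_cost m z t x u = (quad_value m t x)%:E + \sum_(t <= tau < nsteps m)
    (vol_ratio m tau * gcoef m tau * dt m)%:E
    * 'E_P[fun w => (deviation m tau (controlled_state m z t x u tau w) (u tau w) ^+ 2)%R])%E.
Proof.
move=> zn g0 tn adm; pose X := controlled_state m z t x u.
pose D tau w := deviation m tau (X tau w) (u tau w) ^+ 2.
pose N tau w := noise_step m tau (X tau w) (u tau w) (z tau w).
pose c tau := vol_ratio m tau * gcoef m tau * dt m.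
pose F tau := (c tau \o* D tau) \+ N tau.
have aX tau : (t <= tau < nsteps m)%N -> adapted_state tau (X tau).
  move=> /andP[ttau taun]; apply: adapted_controlled_state => //; first exact: zn.1.
  by rewrite ttau ltnW.
have D1 tau : (t <= tau < nsteps m)%N -> D tau \in Lfun P 1.
  move=> ttau; apply: Lfun2_sqr_Lfun1.
  by have [] := adapted_deviation (aX _ ttau) (adm _ ttau).
have N1 tau : (t <= tau < nsteps m)%N -> N tau \in Lfun P 1 /\ ('E_P[N tau] = 0)%E.
  move=> /[dup] ttau /andP[_ taun].
  exact: noise_step_centered zn taun (aX _ ttau) (adm _ ttau).
have cD1 tau : (t <= tau < nsteps m)%N -> c tau \o* D tau \in Lfun P 1.
  by move=> ttau; apply: Lfun_scale => //; exact: D1.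
have F1 tau : (t <= tau < nsteps m)%N -> F tau \in Lfun P 1.
  by move=> ttau; apply: rpredD; [exact: cD1|exact: (N1 _ ttau).1].
rewrite /expected_cost.
have -> : (fun w => total_cost m t x (u ^~ w) (fun i => z i w)) =
    cst (quad_value m t x) \+ (fun w => \sum_(t <= tau < nsteps m) F tau w).
  apply/funext => w; rewrite total_costE//=; congr (_ + _).
  by apply: eq_bigr => tau _; rewrite /F/= mulrC.
have [S1 ES] := expectation_sum_nat F1.
rewrite expectationD//; last exact: Lfun_cst.
rewrite expectation_cst ES; congr (_ + _)%E.
apply: eq_big_nat => tau ttau.
rewrite expectationD ?(N1 _ ttau).2 ?adde0 ?expectationZl//; [exact: D1|exact: cD1|].
exact: (N1 _ ttau).1.
Qed.

(** The closed loop has its own recursion: the feedback reads the state, while [controlled_state]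
    takes the whole control as given. [controlled_feedback] reconciles the two. *)
Fixpoint feedback_state t x (n : nat) (w : T) : 'cV[R]_2 :=
  if n is n'.+1 then
    let y := feedback_state t x n' w in
    next_state m (t + n') y (dot (kgain m (t + n')) y + foffset m (t + n')) (z (t + n')%N w)
  else x.

Definition feedback t x (tau : nat) (w : T) : R :=
  dot (kgain m tau) (feedback_state t x (tau - t) w) + foffset m tau.

Lemma controlled_feedback t x tau w :
  controlled_state m z t x (feedback t x) tau w = feedback_state t x (tau - t) w.
Proof.
rewrite /controlled_state /state; elim: (tau - t)%N => //= n ->.
by rewrite /feedback addKn.
Qed.

(** By induction along the trajectory: an affine function of an adapted state is adapted, and so is
    the next state one step later. *)
Lemma admissible_feedback t x :
  (forall i, (i < nsteps m)%N -> standard_normal (z i)) -> admissible m z t (feedback t x).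
Proof.
move=> nz.
have aF s X : adapted_state s X ->
    adapted s (fun w => dot (kgain m s) (X w) + foffset m s).
  by move=> aX; apply: adapted_L2D; [exact: adapted_dot|exact: adapted_L2_cst].
have aS n : (t + n <= nsteps m)%N -> adapted_state (t + n) (feedback_state t x n).
  elim: n => [_ i|n IH]; first exact: adapted_L2_cst.
  rewrite addnS => tn; have aX := IH (ltnW tn).
  apply: adapted_next_state.
  - by move=> i; apply: adapted_L2S; exact: aX.
  - by apply: adapted_L2S; exact: aF.
  - by apply: adapted_L2_noise; exact: nz.
move=> tau /andP[ttau taun]; apply: aF.
by rewrite -[X in adapted_state X](subnKC ttau); apply: aS; rewrite subnKC// ltnW.
Qed.

End controlled_cost.

(** * Optimality and almost sure uniqueness of the feedback *)

Section optimal_control.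
Context {d : measure_display} {T : measurableType d} {R : realType}
        {P : probability T R}.
Context (m : execution_problem R) (z : nat -> {RV P >-> R}).
Context (z_iid : iid_standard_normal (nsteps m) z).
Context (dt_gt0 : 0 < dt m).
Context (Q0_gt0 : 0 < init_qty m).
Context (v_ge0 : forall t, (t < nsteps m)%N -> 0 <= volume m t).
Context (g_gt0 : forall t, (t < nsteps m)%N -> 0 < gcoef m t).

Let g_neq0 t : (t < nsteps m)%N -> gcoef m t != 0.
Proof. by move=> tn; rewrite gt_eqF// g_gt0. Qed.

Let coef_ge0 t : (t < nsteps m)%N -> 0 <= vol_ratio m t * gcoef m t * dt m.
Proof.
move=> tn; rewrite !mulr_ge0 ?invr_ge0//; [exact: v_ge0|exact: ltW|exact/ltW/g_gt0|exact: ltW].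
Qed.

Let mean_sqr_ge0 (f : T -> R) : (0 <= 'E_P[fun w => (f w ^+ 2)%R])%E.
Proof. by apply: expectation_ge0 => w; exact: sqr_ge0. Qed.

Lemma expected_cost_ge t x u : (t <= nsteps m)%N -> admissible m z t u ->
  ((quad_value m t x)%:E <= expected_cost m z t x u)%E.
Proof.
move=> tn adm; rewrite expected_costE// leeDl// big_nat sume_ge0// => tau /andP[_ taun].
by rewrite mule_ge0// lee_fin coef_ge0.
Qed.

Lemma expected_cost_feedback t x : (t <= nsteps m)%N ->
  expected_cost m z t x (feedback m z t x) = (quad_value m t x)%:E.
Proof.
move=> tn; rewrite expected_costE//; last exact/admissible_feedback/z_iid.1.
rewrite big1 ?adde0// => tau _.
rewrite (_ : (fun w => _) = cst 0) ?expectation_cst ?mule0//.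
apply/funext => w.
by rewrite controlled_feedback /deviation /feedback subrr expr0n.
Qed.

(** The lower bound [expected_cost_ge] is attained by [feedback]. *)
Lemma value_quad t x : (t <= nsteps m)%N -> value m z t x = (quad_value m t x)%:E.
Proof.
move=> tn; apply/eqP; rewrite eq_le; apply/andP; split.
  apply: ereal_inf_lbound; exists (feedback m z t x).
    exact/admissible_feedback/z_iid.1.
  exact: expected_cost_feedback.
by apply: le_ereal_inf_tmp => _ [u adm <-]; exact: expected_cost_ge.
Qed.

Lemma optimal_feedback t x : (t <= nsteps m)%N -> optimal m z t x (feedback m z t x).
Proof.
move=> tn; split; first exact/admissible_feedback/z_iid.1.
by rewrite value_quad// expected_cost_feedback.
Qed.

(** Optimality forces every weighted mean square deviation to vanish; where the volume is positive
    so is the weight, and the deviation is then almost surely zero. *)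
Lemma optimal_ae_feedback t x u tau : (t <= nsteps m)%N -> optimal m z t x u ->
  (t <= tau < nsteps m)%N -> 0 < volume m tau ->
  {ae P, forall w,
     u tau w = dot (kgain m tau) (controlled_state m z t x u tau w) + foffset m tau}.
Proof.
move=> tn [adm]; rewrite value_quad// expected_costE// => opt ttau v_gt0.
have /andP[_ taun] := ttau.
pose D w := deviation m tau (controlled_state m z t x u tau w) (u tau w).
have D2 : D \in Lfun P 2%:E.
  have [] // := @adapted_deviation _ _ _ _ m z tau (controlled_state m z t x u tau)
    (u tau) _ (adm _ ttau).
  apply: adapted_controlled_state => //; first exact: z_iid.1.
  by have /andP[-> /ltnW] := ttau.
(* Finiteness of [quad_value] allows the cancellation, leaving a sum of nonnegative terms equal to
   0. *)
move: opt => /(congr1 (fun y => y - (quad_value m t x)%:E)%E).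
rewrite addeAC subee// add0e => /eqP.
rewrite big_nat seq_psume_eq0 => [/allP|i /andP[_ ?]]; last by rewrite mule_ge0// lee_fin coef_ge0.
move=> /(_ tau); rewrite mem_index_iota ttau => /(_ isT).
rewrite implyTb mule_eq0 eqe => /orP[/eqP c0|/eqP ED0].
  have : 0 < vol_ratio m tau * gcoef m tau * dt m.
    by rewrite !mulr_gt0 ?invr_gt0// g_gt0.
  by rewrite c0 ltxx.
have iD := Lfun2_integrable_sqr D2.
have : (\int[P]_w `|(D w ^+ 2)%:E| = 0)%E.
  rewrite -[RHS]ED0 [in RHS]unlock; apply: eq_integral => w _.
  by rewrite gee0_abs// lee_fin sqr_ge0.
move/(ae_eq_integral_abs P measurableT (measurable_int _ iD)).
apply: filterS => w /(_ I) /= [/eqP]; rewrite sqrf_eq0 subr_eq0 => /eqP; exact.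
Qed.

End optimal_control.

Theorem theorem1 (R : realType) (d : measure_display) (T : measurableType d)
  (P : probability T R) (z : nat -> {RV P >-> R}) (m : execution_problem R)
  (z_iid : iid_standard_normal (nsteps m) z)
  (dt_gt0 : 0 < dt m) (Q0_gt0 : 0 < init_qty m)
  (v_ge0 : forall t, (t < nsteps m)%N -> 0 <= volume m t)
  (g_gt0 : forall t, (t < nsteps m)%N -> 0 < gcoef m t) :
  (* the value function is quadratic *)
  (forall t x, (t <= nsteps m)%N ->
     value m z t x
     = (qform (Pmat m t) x + dot (bvec m t) x + econst m t)%:E) /\
  (* the affine feedback is optimal *)
  (forall t x, (t <= nsteps m)%N ->
     exists u : nat -> T -> R,
       optimal m z t x u /\
       forall tau w, (t <= tau < nsteps m)%N ->
         u tau w = dot (kgain m tau) (controlled_state m z t x u tau w)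
                   + foffset m tau) /\
  (* every optimal control is this feedback, except where the market volume
     is zero and the control has no effect *)
  (forall t x (u : nat -> T -> R), (t <= nsteps m)%N ->
     optimal m z t x u ->
     forall tau, (t <= tau < nsteps m)%N -> 0 < volume m tau ->
       {ae P, forall w,
         u tau w = dot (kgain m tau) (controlled_state m z t x u tau w)
                   + foffset m tau}) /\
  (* feedback coefficients and backward scheme *)
  (forall t, (t < nsteps m)%N ->
     let a := vol_ratio m t in let w := impact m t in
     let kappa := mean_rev m t in
     let k := kgain m t in let f := foffset m t in let g := gcoef m t in
     let P' := Pmat m t.+1 in let b' := bvec m t.+1 in
     let e' := econst m t.+1 in
     [/\ g = temp_impact m t + a * (w^T *m P' *m w) 0 0 * dt m,
         k = - g^-1 *:
             ((1%:M - (kappa * dt m) *: J1) *m P'^T *m w + 2^-1 *: e1),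
         f = - ((dot b' w + half_spread m t) / (2 * g)) &
         [/\ Pmat m t = P' - (kappa * dt m) *: (J1 *m P' + P' *m J1)
               + (kappa ^+ 2 * dt m ^+ 2) *: (J1 *m P' *m J1)
               + dt m *: (diag2 0 (urgency m t) - (a * g) *: (k *m k^T)),
             bvec m t = b' - dt m *: ((2 * a * g * f) *: k
                                      + kappa *: (J1 *m b')) &
             econst m t = e' + volatility m t ^+ 2 * (e1^T *m P' *m e1) 0 0
               - a * g * f ^+ 2 * dt m]]) /\
  [/\ Pmat m (nsteps m) = diag2 0 (terminal_penalty m),
      bvec m (nsteps m) = 0 & econst m (nsteps m) = 0].
Proof.
split=> [t x tn|]; first exact: value_quad.
split=> [t x tn|].
  exists (feedback m z t x); split=> [|tau w _]; first exact: optimal_feedback.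
  by rewrite controlled_feedback.
split=> [t x u tn opt tau|]; first exact: optimal_ae_feedback.
split=> [t tn /=|]; last by rewrite /Pmat /bvec /econst subnn.
(* The formulas for [g], [k] and [f] hold by definition; only the three recursions need
   re-indexing. *)
by have [-> -> ->] := coefs_step tn.
Qed.
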